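(* Let $(X,d)$ be a metric space with basepoint $e\in X$. The function $$d_{\mathbb{Z}[X]}(x,y):=d_{\mathbb{N}[X]}\bigl(x^{+}+y^{-},\,y^{+}+x^{-}\bigr),\qquad x,y\in\mathbb{Z}[X],$$ where $x=x^+-x^-$ and $y=y^+-y^-$ with $x^{\pm},y^{\pm}\in\mathrm{SP}(X)$, is well defined (independent of the chosen decompositions) and defines a metric on $\mathbb{Z}[X]$.
   Context: Let $(X,d)$ be a metric space with distinguished basepoint $e\in X$. For $n\ge 1$, $\mathrm{SP}^n(X)=X^n/S_n$ is the quotient of $X^n$ by the coordinate-permutation action of the symmetric group $S_n$; the orbit of $(x_1,\dots,x_n)$ is written $[x_1,\dots,x_n]$. The map $[x_1,\dots,x_n]\mapsto[x_1,\dots,x_n,e]$ embeds $\mathrm{SP}^n(X)$ in $\mathrm{SP}^{n+1}(X)$, and the set $\mathrm{SP}(X)$ is the union $\bigcup_{n\ge1}\mathrm{SP}^n(X)$ of the increasing sequence so obtained. Thus elements of $\mathrm{SP}(X)$ are finite unordered lists $[x_1,\dots,x_m]$ of points of $X$, with $[x_1,\dots,x_m]=[x_1,\dots,x_m,e]$. Under concatenation $[x_1,\dots,x_m]+[y_1,\dots,y_n]=[x_1,\dots,x_m,y_1,\dots,y_n]$, $\mathrm{SP}(X)$ is a commutative monoid with identity $[e]$; its elements are also written as finite formal sums $\sum a_i x_i$ with nonnegative integer coefficients recording multiplicities. Matching distance: for $[x_1,\dots,x_m],[y_1,\dots,y_n]\in \mathrm{SP}(X)$ and $N\ge m+n$ let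 $\mathbf{x}_N=(x_1,\dots,x_m,e,\dots,e)$ and $\mathbf{y}_N=(y_1,\dots,y_n,e,\dots,e)$ be the lists padded with copies of $e$ to length $N$, and let $\mathbf{x}_N(i)$, $\mathbf{y}_N(i)$ be their $i$-th entries. Then $$d_{\mathbb{N}[X]}([x_1,\dots,x_m],[y_1,\dots,y_n]):=\inf_{N\ge m+n}\ \min_{\sigma\in S_N}\ \sum_{i=1}^N d\bigl(\mathbf{x}_N(i),\mathbf{y}_N(\sigma(i))\bigr),$$ which is a well-defined metric on the set $\mathrm{SP}(X)$. The metric space $(\mathrm{SP}(X),d_{\mathbb{N}[X]})$ is denoted $\mathbb{N}[X]$. $\mathbb{Z}[X]$ is the free abelian group of finite formal sums $\sum b_j y_j$ with $b_j\in\mathbb{Z}$, $y_j\in X$, in which the basepoint $e$ is identified with the zero element (so it is the group completion of $\mathbb{N}[X]$). Every $x\in\mathbb{Z}[X]$ can be written $x=x^+-x^-$ with $x^+,x^-$ finite formal sums with nonnegative coefficients, i.e. $x^{\pm}\in \mathrm{SP}(X)$. *)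

(* Defs.v *)
From HB Require Import structures.
From mathcomp Require Import all_boot all_order all_fingroup all_algebra.
From mathcomp Require Import generic_quotient ring_quotient.
From mathcomp.multinomials Require Import freeg.
From mathcomp Require Import all_classical all_reals all_analysis.
From mathcomp Require Import zify.

Set Implicit Arguments.
Unset Strict Implicit.
Unset Printing Implicit Defensive.

Import Order.TTheory GRing.Theory Num.Theory.

Local Open Scope ring_scope.
Local Open Scope quotient_scope.

Section InfiniteSymmetricProduct.
Context (X : choiceType) (e : X).
Implicit Types s t u : seq X.

Definition pad N s := s ++ nseq (N - size s) e.

(* The orbits of [s] and [t] have the same image in SP^(m + n), where
   m = size s and n = size t. The empty list is allowed; it is equivalent to
   [:: e]. *)
Definition sp_equiv s t :=
  perm_eq (pad (size s + size t) s) (pad (size s + size t) t).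

Lemma count_pad N s (x : X) : x != e -> count_mem x (pad N s) = count_mem x s.
Proof.
by move=> xe; rewrite count_cat count_nseq /= eq_sym (negbTE xe) mul0n addn0.
Qed.

Lemma size_pad N s : (size s <= N)%N -> size (pad N s) = N.
Proof. by move=> sN; rewrite size_cat size_nseq subnKC. Qed.

Lemma nth_pad N s i : nth e (pad N s) i = nth e s i.
Proof.
rewrite nth_cat nth_nseq; case: ltnP => // si; rewrite nth_default//.
by case: ifP.
Qed.

Lemma perm_padP N s t : (size s <= N)%N -> (size t <= N)%N ->
  reflect (forall x, x != e -> count_mem x s = count_mem x t)
          (perm_eq (pad N s) (pad N t)).
Proof.
move=> sN tN; apply: (iffP idP) => [/seq.permP st x xe|st].
  by rewrite -(count_pad N s xe) -(count_pad N t xe) st.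
apply/seq.permP => a.
have stE x : x != e -> count_mem x (pad N s) = count_mem x (pad N t).
  by move=> xe; rewrite !count_pad// st.
move: a; apply/seq.permP/allP => x _ /=; apply/eqP.
have [->|/stE//] := eqVneq x e.
have sE := count_predC (pred1 e) (pad N s).
have tE := count_predC (pred1 e) (pad N t).
suff E : count (predC (pred1 e)) (pad N s) = count (predC (pred1 e)) (pad N t).
  by apply: (@addIn (count (predC (pred1 e)) (pad N s))); rewrite sE E tE !size_pad.
rewrite -!size_filter; apply: perm_size; apply/allP => y _ /=; apply/eqP.
rewrite !count_filter.
have [->|ye] := eqVneq y e.
  by rewrite !(@eq_count _ _ pred0) ?count_pred0// => z /=; case: eqP.
have yE : predI (pred1 y) (predC (pred1 e)) =1 pred1 y.
  by move=> z /=; case: eqVneq => // ->.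
by rewrite !(eq_count yE) stE.
Qed.

Lemma sp_equivP s t :
  reflect (forall x, x != e -> count_mem x s = count_mem x t) (sp_equiv s t).
Proof. by apply: perm_padP; rewrite ?leq_addr ?leq_addl. Qed.

Lemma sp_equiv_is_equiv : equiv_class_of sp_equiv.
Proof.
split=> [s|s t|t s u]; first exact/sp_equivP.
  by apply/sp_equivP/sp_equivP => st x /st.
by move=> /sp_equivP st /sp_equivP tu; apply/sp_equivP => x xe; rewrite st ?tu.
Qed.

Canonical sp_equivRel := EquivRelPack sp_equiv_is_equiv.
Canonical sp_encModRel := defaultEncModRel sp_equiv.

Definition SP := {eq_quot sp_equiv}.
HB.instance Definition _ := Choice.on SP.
HB.instance Definition _ : EqQuotient _ sp_equiv SP := EqQuotient.on SP.

Lemma eqSP s t : (s = t %[mod SP]) <-> sp_equiv s t.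
Proof. by split=> [/eqmodP|st]; last exact/eqmodP. Qed.

Definition sp_zero : SP := \pi_SP [:: e].
Definition sp_add (x y : SP) : SP := \pi_SP (repr x ++ repr y).

Lemma sp_add_pi s t : sp_add (\pi_SP s) (\pi_SP t) = \pi_SP (s ++ t).
Proof.
apply/eqSP/sp_equivP => x xe; rewrite !count_cat.
have rE u : count_mem x (repr (\pi_SP u)) = count_mem x u.
  by have /eqSP/sp_equivP := reprK (\pi_SP u); apply.
by rewrite !rE.
Qed.

Lemma sp_addA : associative sp_add.
Proof.
move=> x y z; elim/quotW: x => s; elim/quotW: y => t; elim/quotW: z => u.
rewrite (sp_add_pi t u) (sp_add_pi s t).
by rewrite (sp_add_pi s (t ++ u)) (sp_add_pi (s ++ t) u) catA.
Qed.

Lemma sp_addC : commutative sp_add.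
Proof.
move=> x y; elim/quotW: x => s; elim/quotW: y => t.
rewrite (sp_add_pi s t) (sp_add_pi t s).
by apply/eqSP/sp_equivP => x _; rewrite !count_cat addnC.
Qed.

Lemma sp_add0 : left_id sp_zero sp_add.
Proof.
move=> x; elim/quotW: x => s; rewrite (sp_add_pi [:: e] s).
by apply/eqSP/sp_equivP => x xe /=; rewrite eq_sym (negbTE xe).
Qed.

HB.instance Definition _ := GRing.isNmodule.Build SP sp_addA sp_addC sp_add0.

End InfiniteSymmetricProduct.

Section MatchingDistance.
Context (R : realType) (X : metricType R) (e : X).
Implicit Types s t : seq X.

Definition matching_cost N s t (sigma : 'S_N) : R :=
  \sum_(i < N) mdist (nth e (pad e N s) i) (nth e (pad e N t) (sigma i)).

Definition min_cost N s t : R :=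
  \big[Num.min/matching_cost s t (1%g : 'S_N)]_(sigma : 'S_N) matching_cost s t sigma.

Definition matching_dist s t : R :=
  inf [set min_cost N s t | N in [set N | (size s + size t <= N)%N]]%classic.

(* Independent of the representatives, see [dN_pi]. *)
Definition dN (x y : SP e) : R := matching_dist (repr x) (repr y).

Lemma min_cost_le N s t (sigma : 'S_N) :
  min_cost N s t <= matching_cost s t sigma.
Proof. by rewrite /min_cost (bigD1 sigma)//= ge_min lexx. Qed.

Lemma min_cost_ex N s t :
  exists sigma : 'S_N, min_cost N s t = matching_cost s t sigma.
Proof.
rewrite /min_cost; elim/big_ind: _ => [|x y [a ->] [b ->]|a _].
- by exists 1%g.
- by case: leP => _; [exists a|exists b].
- by exists a.
Qed.

Lemma min_cost_ge0 N s t : 0 <= min_cost N s t.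
Proof.
have [sigma ->] := min_cost_ex N s t.
by apply: sumr_ge0 => i _; exact: mdist_ge0.
Qed.

Lemma min_costS N s t : (size s <= N)%N -> (size t <= N)%N ->
  min_cost N.+1 s t <= min_cost N s t.
Proof.
move=> sN tN; have [sigma ->] := min_cost_ex N s t.
apply: le_trans (min_cost_le _ _ (lift_perm ord_max ord_max sigma)) _.
rewrite /matching_cost big_ord_recr /= lift_perm_id /= !nth_pad.
rewrite !nth_default// mdistxx addr0 le_eqVlt; apply/orP; left; apply/eqP.
apply: eq_bigr => i _; rewrite !nth_pad.
have -> : widen_ord (leqnSn N) i = fintype.lift ord_max i.
  by apply: val_inj; rewrite /= /bump leqNgt ltn_ord.
by rewrite lift_perm_lift lift_max.
Qed.

Lemma min_cost_homo M N s t : (size s <= M)%N -> (size t <= M)%N ->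
  (M <= N)%N -> min_cost N s t <= min_cost M s t.
Proof.
move=> sM tM /subnK <-; elim: (N - M)%N => [|k]; first by rewrite add0n.
apply: le_trans; rewrite addSn.
by apply: min_costS; [apply: leq_trans sM _|apply: leq_trans tM _];
  rewrite leq_addl.
Qed.

Lemma matching_dist_tail M s t : (size s + size t <= M)%N ->
  matching_dist s t = inf [set min_cost N s t | N in [set N | (M <= N)%N]]%classic.
Proof.
move=> stM; have lb (D : set nat) : has_lbound ((fun N => min_cost N s t) @` D)%classic.
  by exists 0 => _ [N _ <-]; exact: min_cost_ge0.
apply/eqP; rewrite eq_le; apply/andP; split.
- apply: lb_le_inf; first by exists (min_cost M s t), M => /=.
  move=> _ [N /= MN <-]; apply: ge_inf; first exact: lb.
  by exists N => //=; exact: leq_trans stM MN.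
- apply: lb_le_inf.
    by exists (min_cost M s t), M.
  move=> _ [N /= stN <-].
  apply: (@le_trans _ _ (min_cost (maxn M N) s t)).
    by apply: ge_inf; [exact: lb|exists (maxn M N) => //=; rewrite leq_maxl].
  apply: min_cost_homo; rewrite ?leq_maxr//.
    exact: leq_trans (leq_addr _ _) stN.
  exact: leq_trans (leq_addl _ _) stN.
Qed.

Lemma pad_perm N s t : (size s <= N)%N -> (size t <= N)%N -> sp_equiv e s t ->
  exists tau : 'S_N,
    forall i : 'I_N, nth e (pad e N s) i = nth e (pad e N t) (tau i).
Proof.
move=> sN tN /sp_equivP/(perm_padP e sN tN) st.
have /eqP sS := size_pad e sN; have /eqP tS := size_pad e tN.
have /tuple_permP[tau /= tauE] : perm_eq (Tuple sS) (Tuple tS) by [].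
exists tau => i; rewrite tauE.
by rewrite (nth_map i) ?size_enum_ord// nth_ord_enum (tnth_nth e).
Qed.

Lemma min_cost_equiv_le N s s' t t' :
  (size s <= N)%N -> (size t <= N)%N ->
  (size s' <= N)%N -> (size t' <= N)%N ->
  sp_equiv e s s' -> sp_equiv e t t' -> min_cost N s' t' <= min_cost N s t.
Proof.
move=> sN tN s'N t'N /(pad_perm sN s'N)[tau tauE] /(pad_perm tN t'N)[rho rhoE].
have [sigma ->] := min_cost_ex N s t.
apply: le_trans (min_cost_le _ _ (tau^-1 * sigma * rho)%g) _.
rewrite /matching_cost (reindex_inj (@perm_inj _ tau))/=.
rewrite le_eqVlt; apply/orP; left; apply/eqP; apply: eq_bigr => i _.
by rewrite tauE rhoE !permM permK.
Qed.

Lemma matching_dist_equiv s s' t t' :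
  sp_equiv e s s' -> sp_equiv e t t' -> matching_dist s t = matching_dist s' t'.
Proof.
move=> ss' tt'.
have s's : sp_equiv e s' s by rewrite (generic_quotient.equiv_sym (sp_equivRel e)).
have t't : sp_equiv e t' t by rewrite (generic_quotient.equiv_sym (sp_equivRel e)).
rewrite (@matching_dist_tail ((size s + size t) + (size s' + size t'))).
  2: by rewrite leq_addr.
rewrite (@matching_dist_tail ((size s + size t) + (size s' + size t')) s').
  2: by rewrite leq_addl.
congr inf; apply: eq_imagel => N /= MN.
have le k : (k <= size s + size t + (size s' + size t'))%N -> (k <= N)%N.
  by move=> kM; exact: leq_trans kM MN.
by apply/eqP; rewrite eq_le !min_cost_equiv_le//; apply: le; lia.
Qed.

Lemma dN_pi s t : dN (\pi_(SP e) s) (\pi_(SP e) t) = matching_dist s t.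
Proof. by apply: matching_dist_equiv; apply/eqSP; rewrite reprK. Qed.

End MatchingDistance.

Section GroupCompletion.
Context (X : choiceType) (e : X).

(* The subgroup of {freeg X / int} generated by the basis element e. *)
Definition base_multiple : pred {freeg X / int} :=
  fun z => z == << coeff e z *g e >>.

Lemma base_multiple_zmod_closed : zmod_closed base_multiple.
Proof.
split; first by rewrite unfold_in /base_multiple coeff0 freegU0.
move=> x y; rewrite !unfold_in /base_multiple => /eqP xE /eqP yE.
by rewrite coeffB -freegUB -xE -yE.
Qed.

HB.instance Definition _ := GRing.isZmodClosed.Build {freeg X / int}
  base_multiple base_multiple_zmod_closed.

Definition ZX := Quotient.quot (GRing.ZmodClosed.clone _ base_multiple _).
HB.instance Definition _ := GRing.Zmodule.on ZX.

Definition zgen (p : X) : ZX := \pi_ZX << p >>.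

(* Independent of the representative, see [toZX_pi]. *)
Definition toZX (x : SP e) : ZX := \sum_(p <- repr x) zgen p.

Lemma zgen_base : zgen e = 0.
Proof.
rewrite /zgen -[0](raddf0 \pi_ZX); apply/eqP.
rewrite -Quotient.idealrBE subr0 unfold_in /base_multiple.
by rewrite coeffU eqxx mulr1.
Qed.

Lemma toZX_pi (s : seq X) : toZX (\pi_(SP e) s) = \sum_(p <- s) zgen p.
Proof.
have sumE N (t : seq X) : \sum_(p <- pad e N t) zgen p = \sum_(p <- t) zgen p.
  by rewrite big_cat /= big_nseq zgen_base iter_addr_0 mul0rn addr0.
have /eqSP st := reprK (\pi_(SP e) s).
by rewrite /toZX -(sumE (size (repr (\pi_(SP e) s)) + size s) (repr _)) (perm_big _ st) sumE.
Qed.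

Lemma toZX_is_nmod_morphism : nmod_morphism toZX.
Proof.
split; first by rewrite (toZX_pi [:: e]) big_seq1 zgen_base.
move=> x y; elim/quotW: x => s; elim/quotW: y => t.
rewrite -[X in toZX X]/(sp_add (\pi_(SP e) s) (\pi_(SP e) t)) (sp_add_pi e s t).
by rewrite (toZX_pi (s ++ t)) (toZX_pi s) (toZX_pi t) big_cat.
Qed.

HB.instance Definition _ :=
  GRing.isNmodMorphism.Build (SP e) ZX toZX toZX_is_nmod_morphism.

End GroupCompletion.

(* [dZ x y] is given by the stated expression for every choice of the
   decompositions of [x] and [y]; a [dZ] satisfying this exists iff that
   expression does not depend on them. *)
Definition dZ_formula (R : realType) (X : metricType R) (e : X)
    (dZ : ZX e -> ZX e -> R) : Prop :=
  forall (x y : ZX e) (xp xm yp ym : SP e),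
    x = toZX xp - toZX xm -> y = toZX yp - toZX ym ->
    dZ x y = dN (xp + ym) (yp + xm).

Record is_metric (R : numDomainType) (T : Type) (d : T -> T -> R) : Prop := {
  metric_ge0 : forall x y, 0 <= d x y;
  metric_eq0 : forall x y, d x y = 0 <-> x = y;
  metric_symm : forall x y, d x y = d y x;
  metric_trian : forall x y z, d x z <= d x y + d y z
}.

(* Main.v *)
Require Import Defs.
From mathcomp Require Import all_boot all_order all_algebra.
From mathcomp Require Import all_classical all_reals all_analysis.
From mathcomp Require Import all_fingroup generic_quotient.
From mathcomp.multinomials Require Import freeg.

Set Implicit Arguments.
Unset Strict Implicit.
Unset Printing Implicit Defensive.

(** A matching of two finite lists is recorded as a list [l] of pairs of points:
its two projections, read in SP(X), are the matched elements, and its cost is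
the sum of the distances. Padding by [e] becomes the addition of pairs
[(e, e)], which are free. The matching distance is the least cost of such a
coupling, and it is attained ([dN_le_cost], [dN_attained]); from there on, every
property of the distance is an operation on lists of pairs.

The idea that carries the proof is cancellation ([cost_cancel1]). If a point [z]
occurs on both sides, matched as [(z, b)] and [(a, z)], then both pairs can be
replaced by [(a, b)], and the triangle inequality of X says that the cost does
not increase. Removing superfluous copies of [e] this way shows that longer
paddings never help, so that the infimum over all paddings is a minimum;
removing common summands shows that the distance on N[X] is invariant under
translation ([dN_addr]).

Together with the triangle inequality for the matching distance, obtained by
composing couplings along their common middle ([cost_glue]), translation
invariance gives the result. The map SP(X) -> Z[X] is injective ([toZX_inj]), so
two decompositions x+ - x- = x'+ - x'- satisfy x+ + x'- = x'+ + x-; adding the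
same element to both arguments of the distance then turns the formula for one
decomposition into the formula for the other. As every element of Z[X] has a
decomposition ([ZX_decomposition]), this determines the distance. The metric
axioms on Z[X] follow from those on N[X]; for the triangle inequality, suitable
translations turn the three distances into the mutual distances of three
elements of N[X]. *)

Import Order.TTheory GRing.Theory Num.Theory.

Local Open Scope ring_scope.
Local Open Scope quotient_scope.

(** * Lists up to permutation and padding *)

Lemma perm_map_cons (T U : eqType) (f : T -> U) (l : seq T) (u : U)
    (s : seq U) :
  perm_eq (map f l) (u :: s) ->
  exists p l', [/\ f p = u, perm_eq l (p :: l') & perm_eq (map f l') s].
Proof.
move=> lE; have : u \in map f l by rewrite (perm_mem lE) mem_head.
move=> /mapP[p pl uE]; exists p, (rem p l).
split=> //; first exact: perm_to_rem.
rewrite -(perm_cons u) -(permPr lE) {1}uE perm_sym.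
exact: (perm_map f (perm_to_rem pl)).
Qed.

Section SymmetricProduct.
Context (X : choiceType) (e : X).
Implicit Types s t : seq X.

Lemma pi_SPP s t :
  (\pi_(SP e) s = \pi_(SP e) t) <->
  (forall x, x != e -> count_mem x s = count_mem x t).
Proof. by split=> [/eqSP/sp_equivP|st]; last exact/eqSP/sp_equivP. Qed.

Lemma pi_perm s t : perm_eq s t -> \pi_(SP e) s = \pi_(SP e) t.
Proof. by move=> /seq.permP st; apply/pi_SPP => x _; apply: st. Qed.

Lemma pi_pad N s : \pi_(SP e) (pad e N s) = \pi_(SP e) s.
Proof. by apply/pi_SPP => x xe; rewrite count_pad. Qed.

Lemma perm_pad N s t : (size s <= N)%N -> (size t <= N)%N ->
  \pi_(SP e) s = \pi_(SP e) t -> perm_eq (pad e N s) (pad e N t).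
Proof. by move=> sN tN /pi_SPP st; apply/perm_padP. Qed.

Lemma pi_cat s t : \pi_(SP e) (s ++ t) = \pi_(SP e) s + \pi_(SP e) t.
Proof. by rewrite -sp_add_pi. Qed.

End SymmetricProduct.

(** * Couplings and their cost *)

Section Couplings.
Context (R : realType) (X : metricType R).
Implicit Types (l : seq (X * X)) (s t : seq X).

Definition cost l : R := \sum_(p <- l) mdist p.1 p.2.

Lemma cost_ge0 l : 0 <= cost l.
Proof. by apply: sumr_ge0 => p _; exact: mdist_ge0. Qed.

Lemma cost_perm l l' : perm_eq l l' -> cost l = cost l'.
Proof. by move=> ll'; rewrite /cost (perm_big _ ll'). Qed.

Lemma cost_cons p l : cost (p :: l) = mdist p.1 p.2 + cost l.
Proof. by rewrite /cost big_cons. Qed.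

Lemma cost_cat l l' : cost (l ++ l') = cost l + cost l'.
Proof. by rewrite /cost big_cat. Qed.

Lemma cost_diag s : cost [seq (x, x) | x <- s] = 0.
Proof. by rewrite /cost big_map big1// => x _; rewrite mdistxx. Qed.

(** If [z] is matched to [b], and [a] to [z], matching [a] to [b] directly is no
more expensive. *)
Lemma cost_cancel1 l z s t :
  perm_eq (unzip1 l) (z :: s) -> perm_eq (unzip2 l) (z :: t) ->
  exists l', [/\ perm_eq (unzip1 l') s, perm_eq (unzip2 l') t
               & cost l' <= cost l].
Proof.
move=> l1 l2; have [[z' b] [l' [/= -> lE l's]]] := perm_map_cons l1.
rewrite (cost_perm lE) cost_cons /=.
have l't : perm_eq (b :: unzip2 l') (z :: t).
  by rewrite -(permPr l2) perm_sym; exact: (perm_map snd lE).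
have [bz|bz] := eqVneq b z.
  exists l'; split=> //; last by rewrite lerDr mdist_ge0.
  by move: l't; rewrite bz perm_cons.
have zl' : z \in unzip2 l'.
  by have := perm_mem l't z; rewrite !inE eqxx eq_sym (negbTE bz).
have [[a z2] [l'' [/= z2E l'E l''E]]] := perm_map_cons (perm_to_rem zl').
rewrite {z2}z2E in l'E *; exists ((a, b) :: l''); split => /=.
- by rewrite -(permPr l's) perm_sym; exact: (perm_map fst l'E).
- rewrite -(perm_cons z) -(permPr l't) perm_sym.
  have := perm_map snd l'E; rewrite /= -(perm_cons b) => /perm_trans; apply.
  exact: (permEl (perm_catCA [:: b] [:: z] _)).
- rewrite (cost_perm l'E) !cost_cons /= addrA lerD2r addrC.
  exact: metric_triangle.
Qed.

Lemma cost_cancel l u s t :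
  perm_eq (unzip1 l) (u ++ s) -> perm_eq (unzip2 l) (u ++ t) ->
  exists l', [/\ perm_eq (unzip1 l') s, perm_eq (unzip2 l') t
               & cost l' <= cost l].
Proof.
elim: u l => [|z u IH] l /=; first by exists l.
move=> l1 l2; have [l' [l'1 l'2 l'l]] := cost_cancel1 l1 l2.
have [l'' [? ? l''l']] := IH _ l'1 l'2.
by exists l''; split=> //; exact: le_trans l''l' l'l.
Qed.

(** Couplings compose: the pairs [(a, b)] and [(b, c)] merge into [(a, c)]. *)
Lemma cost_glue l1 l2 : perm_eq (unzip2 l1) (unzip1 l2) ->
  exists l, [/\ perm_eq (unzip1 l) (unzip1 l1), perm_eq (unzip2 l) (unzip2 l2)
              & cost l <= cost l1 + cost l2].
Proof.
elim: l1 l2 => [|[a b] l1 IH] l2 /=.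
  move=> /perm_size; rewrite size_map => /esym/size0nil ->.
  by exists [::]; split=> //; rewrite lerDl cost_ge0.
rewrite perm_sym => /perm_map_cons[[b' c] [l2' [/= -> l2E]]].
rewrite perm_sym => /IH[l [l1E l2'E lc]].
exists ((a, c) :: l); split=> /=; first by rewrite perm_cons.
  by rewrite (permPr (perm_map snd l2E)) /= perm_cons.
rewrite (cost_perm l2E) !cost_cons /= addrACA.
by apply: lerD lc; exact: metric_triangle.
Qed.

Context (e : X).

(** The marginals are compared in SP(X), not as lists, so that a coupling may
match points to the basepoint without its lists having been padded. *)
Definition coupling (x y : SP e) l :=
  \pi_(SP e) (unzip1 l) = x /\ \pi_(SP e) (unzip2 l) = y.

Lemma cost_pad N l : cost (pad (e, e) N l) = cost l.
Proof.
rewrite cost_cat; have := cost_diag (nseq (N - size l) e).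
by rewrite map_nseq => ->; rewrite addr0.
Qed.

Lemma unzip1_pad N l : unzip1 (pad (e, e) N l) = pad e N (unzip1 l).
Proof. by rewrite /unzip1 /pad map_cat map_nseq size_map. Qed.

Lemma unzip2_pad N l : unzip2 (pad (e, e) N l) = pad e N (unzip2 l).
Proof. by rewrite /unzip2 /pad map_cat map_nseq size_map. Qed.

Lemma coupling_add x y x' y' l l' :
  coupling x y l -> coupling x' y' l' -> coupling (x + x') (y + y') (l ++ l').
Proof.
by move=> [<- <-] [<- <-]; split; rewrite /unzip1 /unzip2 map_cat pi_cat.
Qed.

Lemma coupling_diag s :
  coupling (\pi_(SP e) s) (\pi_(SP e) s) [seq (x, x) | x <- s].
Proof. by split; rewrite /unzip1 /unzip2 -map_comp map_id. Qed.

(** The lists are padded to a common length, which turns equality in SP(X) into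
an honest permutation; then the points of [z] are cancelled one at a time. *)
Lemma coupling_cancel x y z l : coupling (x + z) (y + z) l ->
  exists2 l', coupling x y l' & cost l' <= cost l.
Proof.
elim/quotW: x => s; elim/quotW: y => t; elim/quotW: z => u.
rewrite -!(addrC (\pi_(SP e) u)) -!pi_cat => -[l1 l2].
pose N := (size l + size (u ++ s) + size (u ++ t))%N.
have pad_cat (v : seq X) :
    pad e N (u ++ v) = u ++ (v ++ nseq (N - size (u ++ v)) e).
  by rewrite /pad catA.
have [] := @cost_cancel (pad (e, e) N l) u (s ++ nseq (N - size (u ++ s)) e)
    (t ++ nseq (N - size (u ++ t)) e).
- rewrite unzip1_pad -pad_cat; apply: perm_pad => //.
    by rewrite size_map /N -addnA leq_addr.
  by rewrite /N addnAC leq_addl.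
- rewrite unzip2_pad -pad_cat; apply: perm_pad => //; last by rewrite leq_addl.
  by rewrite size_map /N -addnA leq_addr.
move=> l' [l'1 l'2]; rewrite cost_pad => l'l; exists l' => //.
have pi_nseq (v : seq X) k : \pi_(SP e) (v ++ nseq k e) = \pi_(SP e) v.
  apply/pi_SPP => x xe.
  by rewrite count_cat count_nseq /= eq_sym (negbTE xe) mul0n addn0.
by split; rewrite ?(pi_perm e l'1) ?(pi_perm e l'2) pi_nseq.
Qed.

(** A coupling is a matching by the identity permutation of its own two
projections, and the minimal cost depends on these only up to [sp_equiv]. *)
Lemma min_cost_le_cost N s t l :
  (size s <= N)%N -> (size t <= N)%N -> (size l <= N)%N ->
  coupling (\pi_(SP e) s) (\pi_(SP e) t) l -> min_cost e N s t <= cost l.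
Proof.
move=> sN tN lN [/eqSP l1 /eqSP l2].
apply: (@le_trans _ _ (min_cost e N (unzip1 l) (unzip2 l))).
  by apply: min_cost_equiv_le; rewrite ?size_map.
apply: le_trans (min_cost_le _ _ _ 1%g) _.
rewrite -(cost_pad N) /cost (big_nth (e, e)) big_mkord size_pad//.
rewrite le_eqVlt; apply/orP; left; apply/eqP; apply: eq_bigr => i _.
rewrite perm1 -unzip1_pad -unzip2_pad.
by rewrite !(nth_map (e, e)) ?size_pad.
Qed.

Lemma dN_le_cost x y l : coupling x y l -> dN x y <= cost l.
Proof.
move=> [<- <-]; rewrite dN_pi.
pose N := (size (unzip1 l) + size (unzip2 l))%N.
apply: (@le_trans _ _ (min_cost e N (unzip1 l) (unzip2 l))).
  apply: ge_inf; last by exists N => /=.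
  by exists 0 => _ [M _ <-]; exact: min_cost_ge0.
apply: min_cost_le_cost; rewrite ?leq_addr ?leq_addl//.
by rewrite /N size_map leq_addr.
Qed.

(** Conversely an optimal permutation [sigma] is read as the list of the pairs
that it matches. *)
Lemma min_cost_coupling N s t : (size s <= N)%N -> (size t <= N)%N ->
  exists l, [/\ perm_eq (unzip1 l) (pad e N s), perm_eq (unzip2 l) (pad e N t)
              & cost l = min_cost e N s t].
Proof.
move=> sN tN; have [sigma ->] := min_cost_ex e N s t.
pose l := [seq (nth e (pad e N s) i, nth e (pad e N t) (sigma i)) | i : 'I_N].
have ordE (v : seq X) : (size v <= N)%N ->
    pad e N v = [seq nth e (pad e N v) i | i : 'I_N].
  move=> vN; rewrite -{1}(mkseq_nth e (pad e N v)) size_pad// /mkseq.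
  by rewrite -val_enum_ord -map_comp.
exists l; split.
- by rewrite /unzip1 -map_comp {2}(ordE s).
- have sigmaE : perm_eq (map sigma (enum 'I_N)) (enum 'I_N).
    apply: uniq_perm; rewrite ?(map_inj_uniq perm_inj) ?enum_uniq//.
    move=> i; rewrite mem_enum inE; apply/mapP; exists (sigma^-1%g i).
      by rewrite mem_enum.
    by rewrite permKV.
  rewrite (ordE t)// -(permPr (perm_map _ sigmaE)).
  by rewrite /unzip2 -!map_comp.
- by rewrite /cost big_map big_enum.
Qed.

(** The infimum is reached at the shortest padding: a matching of longer paddings
contains at least [N - M] additional copies of [e] on both sides, and cancelling
them yields a matching of the shortest ones that is no more expensive. *)
Lemma dN_attained x y : exists2 l, coupling x y l & cost l = dN x y.
Proof.
suff [l xyl ldN] : exists2 l, coupling x y l & cost l <= dN x y.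
  by exists l => //; apply/eqP; rewrite eq_le ldN dN_le_cost.
rewrite /dN; set s := repr x; set t := repr y; pose M := (size s + size t)%N.
have sM : (size s <= M)%N by rewrite leq_addr.
have tM : (size t <= M)%N by rewrite leq_addl.
have [l [l1 l2 lE]] := min_cost_coupling sM tM; exists l.
  by split; rewrite ?(pi_perm e l1) ?(pi_perm e l2) pi_pad reprK.
rewrite lE; apply: lb_le_inf; first by exists (min_cost e M s t), M => /=.
move=> _ [N /= MN <-].
have [l' [l'1 l'2 <-]] := min_cost_coupling (leq_trans sM MN) (leq_trans tM MN).
have padE v : (size v <= M)%N ->
    perm_eq (pad e N v) (nseq (N - M) e ++ pad e M v).
  move=> vM; rewrite perm_sym perm_catC -catA -nseqD.
  rewrite /pad [X in nseq X e](_ : _ = N - size v)%N//.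
  by rewrite addnC addnBA// subnK.
have [l'' [l''1 l''2]] :=
  cost_cancel (perm_trans l'1 (padE s sM)) (perm_trans l'2 (padE t tM)).
apply: le_trans; apply: min_cost_le_cost => //.
  by have /perm_size := l''1; rewrite size_map size_pad// => ->.
by split; rewrite ?(pi_perm e l''1) ?(pi_perm e l''2) pi_pad.
Qed.

Lemma dN_ge0 (x y : SP e) : 0 <= dN x y.
Proof. by have [l _ <-] := dN_attained x y; exact: cost_ge0. Qed.

Lemma dNxx (x : SP e) : dN x x = 0.
Proof.
elim/quotW: x => s; apply/eqP; rewrite eq_le dN_ge0 andbT -(cost_diag s).
exact/dN_le_cost/coupling_diag.
Qed.

(** Since the infimum is attained, distance zero provides a coupling whose pairs
all lie on the diagonal. *)
Lemma dN_eq0 (x y : SP e) : dN x y = 0 -> x = y.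
Proof.
have [l [<- <-] <-] := dN_attained x y.
elim: l => // -[a b] l IH; rewrite cost_cons /= => /eqP.
rewrite paddr_eq0 ?mdist_ge0 ?cost_ge0// => /andP[/eqP/mdist_positivity ->].
by move=> /eqP/IH lE; rewrite (pi_cat e [:: b]) (pi_cat e [:: b] (unzip2 l)) lE.
Qed.

Lemma dN_sym (x y : SP e) : dN x y = dN y x.
Proof.
suff le (u v : SP e) : dN u v <= dN v u by apply/eqP; rewrite eq_le !le.
have [l [l1 l2] <-] := dN_attained v u.
have -> : cost l = cost [seq (p.2, p.1) | p <- l].
  by rewrite /cost big_map; apply: eq_bigr => p _; rewrite metric_sym.
by apply: dN_le_cost; split; rewrite /unzip1 /unzip2 -map_comp.
Qed.

Lemma dN_triangle (x y z : SP e) : dN x z <= dN x y + dN y z.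
Proof.
have [l1 [l1x l1y] <-] := dN_attained x y.
have [l2 [l2y l2z] <-] := dN_attained y z.
pose N := (size l1 + size l2)%N.
have [] := @cost_glue (pad (e, e) N l1) (pad (e, e) N l2).
  rewrite unzip1_pad unzip2_pad; apply: perm_pad;
    rewrite ?size_map ?leq_addr ?leq_addl//.
  by rewrite l1y l2y.
move=> l [lx lz]; rewrite !cost_pad; apply: le_trans; apply: dN_le_cost.
by split; rewrite ?(pi_perm e lx) ?(pi_perm e lz) ?unzip1_pad ?unzip2_pad
  pi_pad.
Qed.

(** One inequality completes a coupling by diagonal pairs, the other one is
cancellation. *)
Lemma dN_addr (x y z : SP e) : dN (x + z) (y + z) = dN x y.
Proof.
apply/eqP; rewrite eq_le; apply/andP; split.
  have [l xyl <-] := dN_attained x y; elim/quotW: z => s.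
  rewrite -[leRHS]addr0 -(cost_diag s) -cost_cat.
  exact/dN_le_cost/(coupling_add xyl)/coupling_diag.
have [l /coupling_cancel[l' /dN_le_cost xyl' l'l] <-] :=
  dN_attained (x + z) (y + z).
exact: le_trans l'l.
Qed.

End Couplings.

(** * The group completion *)

Section GroupCompletion.
Context (X : choiceType) (e : X).

(** In the free abelian group, an element of the subgroup generated by [e] has no
coefficient at the other points, and these coefficients are the multiplicities
that determine an element of SP(X). *)
Lemma toZX_inj : injective (@toZX X e).
Proof.
move=> x y; elim/quotW: x => s; elim/quotW: y => t; rewrite !toZX_pi.
have zgenE (u : seq X) :
    \sum_(p <- u) zgen e p = \pi_(ZX e) (\sum_(p <- u) << p >>).
  by rewrite raddf_sum.
rewrite !zgenE => /eqP; rewrite -Quotient.idealrBE unfold_in /base_multiple.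
move=> /eqP stE; apply/pi_SPP => x xe.
have := congr1 (coeff x) stE; rewrite coeffU eq_sym (negbTE xe) mulr0 coeffB.
have coeffE (u : seq X) :
    coeff x (\sum_(p <- u) << p >>) = (count_mem x u)%:Z.
  elim: u => [|p u IH]; first by rewrite big_nil coeff0.
  by rewrite big_cons coeffD coeffU mul1r IH /= PoszD natz.
by rewrite !coeffE => /eqP; rewrite subr_eq0 => /eqP[].
Qed.

Lemma ZX_decomposition (x : ZX e) :
  exists p : SP e * SP e, x = toZX p.1 - toZX p.2.
Proof.
elim/quotW: x => f; rewrite -(freeg_sumE f).
elim: (dom f) => [|z l [[xp xm] /= IH]].
  by exists (0, 0); rewrite big_nil /= subrr raddf0.
rewrite big_cons raddfD /= IH.
suff [[a b] /= ->] : exists p : SP e * SP e,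
    \pi_(ZX e) << coeff z f *g z >> = toZX p.1 - toZX p.2.
  by exists (a + xp, b + xm); rewrite /= !raddfD /= addrACA.
have zE : toZX (\pi_(SP e) [:: z]) = zgen e z by rewrite toZX_pi big_seq1.
have piE (k : int) : \pi_(ZX e) << k *g z >> = zgen e z *~ k.
  by rewrite -[k in LHS]intz -freegU_mulz raddfMz.
rewrite piE; case: (coeff z f) => n.
  by exists (\pi_(SP e) [:: z] *+ n, 0); rewrite /= raddf0 subr0 raddfMn /= zE.
by exists (0, \pi_(SP e) [:: z] *+ n.+1); rewrite /= raddf0 sub0r raddfMn /= zE.
Qed.

End GroupCompletion.

(** * The metric on the group completion *)

Theorem proposition5p2 (R : realType) (X : metricType R) (e : X) :
  exists dZ : ZX e -> ZX e -> R,
    [/\ dZ_formula dZ,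
        (forall dZ' : ZX e -> ZX e -> R, dZ_formula dZ' -> dZ' = dZ)
      & is_metric dZ].
Proof.
have [dec decE] := choice (@ZX_decomposition X e).
pose dZ (x y : ZX e) := dN ((dec x).1 + (dec y).2) ((dec y).1 + (dec x).2).
have dZE : dZ_formula dZ.
  move=> x y xp xm yp ym xE yE; rewrite /dZ.
  have swap (z : ZX e) zp zm :
      z = toZX zp - toZX zm -> (dec z).1 + zm = zp + (dec z).2.
    move=> zE; apply: toZX_inj; rewrite !raddfD /=; apply/eqP.
    by rewrite -subr_eq addrAC -decE zE subrK.
  have {}xE := swap _ _ _ xE; have {}yE := swap _ _ _ yE.
  rewrite -(dN_addr _ _ (xm + ym)) -[RHS](dN_addr _ _ ((dec x).2 + (dec y).2)).
  congr dN.
    by rewrite addrACA xE [RHS]addrACA (addrC ym).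
  rewrite (addrC xm) addrACA yE (addrC (dec x).2 (dec y).2).
  by rewrite [RHS]addrACA (addrC xm).
exists dZ; split => //.
  by move=> dZ' dZ'E; apply/funext => x; apply/funext => y; apply: dZ'E.
split=> [x y|x y|x y|x y z].
- exact: dN_ge0.
- split=> [/dN_eq0|->]; last exact: dNxx.
  move=> /(congr1 (@toZX X e)); rewrite !raddfD /= => xyE.
  rewrite (decE x) (decE y); apply/eqP.
  by rewrite subr_eq addrAC -xyE addrK.
- exact: dN_sym.
- (* Adding b.2, c.2 and a.2 to the three distances turns them into the mutual
     distances of a.1 + b.2 + c.2, b.1 + a.2 + c.2 and c.1 + a.2 + b.2. *)
  rewrite /dZ; set a := dec x; set b := dec y; set c := dec z.
  rewrite -(dN_addr _ _ b.2) -(dN_addr (a.1 + b.2) _ c.2).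
  rewrite -(dN_addr (b.1 + c.2) _ a.2) [a.1 + b.2 + c.2]addrAC.
  rewrite [b.1 + a.2 + c.2]addrAC [c.1 + a.2 + b.2]addrAC.
  exact: dN_triangle.
Qed.
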